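(* Let $A$ and $B$ be $C^*$-algebras and let $\theta\colon A\to B$ be an injective $*$-homomorphism. Suppose that there exist a net $(F_\alpha)$ of abelian $C^*$-algebras and nets of contractive maps $\phi_\alpha\colon A \to F_\alpha$ and $2$-contractive maps $\psi_\alpha\colon F_\alpha \to B$ such that for all $x \in A$, $$\|(\theta - \psi_\alpha\circ\phi_\alpha)(x)\| \to 0 \quad\text{as } \alpha \to \infty.$$ Then $A$ is abelian.
   Context: All maps between $C^*$-algebras are bounded linear maps. A map is contractive if it has norm $\le 1$. A map $\phi\colon A\to B$ is $2$-contractive if $\phi\otimes \mathrm{id}_{\mathbb{M}_2}\colon A\otimes \mathbb{M}_2\to B\otimes\mathbb{M}_2$ is contractive, where $\mathbb{M}_2$ is the $C^*$-algebra of $2\times 2$ complex matrices. The nets are indexed by the same directed set. *)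

(* Defs.v *)
From HB Require Import structures.
From mathcomp Require Import all_boot all_order all_algebra.
From mathcomp Require Import complex.
From mathcomp Require Import all_classical all_reals all_analysis.

Set Implicit Arguments.
Unset Strict Implicit.
Unset Printing Implicit Defensive.

Import Order.TTheory GRing.Theory Num.Theory.
Import numFieldNormedType.Exports.

Local Open Scope classical_set_scope.
Local Open Scope complex_scope.
Local Open Scope ring_scope.

(* C*-algebras over the complex field R[i], R being the reals. They need not
   have a unit, so the product is not the product of a MathComp ring, whose
   structures are all unital. The norm takes its values in R[i], as for every
   normedModType over R[i]; these values are nonnegative, hence real. *)
HB.mixin Record isCstarAlgebra (R : realType) (A : Type)
    of CompleteNormedModule R[i] A := {
  cmul : A -> A -> A;
  cstar : A -> A;
  cmulA : forall x y z, cmul x (cmul y z) = cmul (cmul x y) z;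
  cmulDl : forall x y z, cmul (x + y) z = cmul x z + cmul y z;
  cmulDr : forall x y z, cmul x (y + z) = cmul x y + cmul x z;
  cmulZl : forall (c : R[i]) x y, cmul (c *: x) y = c *: cmul x y;
  cmulZr : forall (c : R[i]) x y, cmul x (c *: y) = c *: cmul x y;
  cstarK : forall x, cstar (cstar x) = x;
  cstarD : forall x y, cstar (x + y) = cstar x + cstar y;
  cstarZ : forall (c : R[i]) x, cstar (c *: x) = Num.conj c *: cstar x;
  cstarM : forall x y, cstar (cmul x y) = cmul (cstar y) (cstar x);
  norm_cmul_le : forall x y, `|cmul x y| <= `|x| * `|y|;
  norm_cstar : forall x, `|cmul (cstar x) x| = `|x| ^+ 2
}.

#[short(type="cstarAlgType")]
HB.structure Definition CstarAlgebra (R : realType) :=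
  { A of isCstarAlgebra R A & CompleteNormedModule R[i] A }.

Definition abelian_cstar (R : realType) (A : cstarAlgType R) : Prop :=
  forall x y : A, cmul x y = cmul y x.

Definition star_hom (R : realType) (A B : cstarAlgType R)
    (f : {linear A -> B}) : Prop :=
  (forall x y, f (cmul x y) = cmul (f x) (f y)) /\
  (forall x, f (cstar x) = cstar (f x)).

Definition contractive (R : realType) (A B : cstarAlgType R)
    (f : {linear A -> B}) : Prop :=
  forall x, `|f x| <= `|x|.

Section Amplification.
Variables (R : realType) (A : cstarAlgType R).

(* The *-algebra structure of A (x) M_2, seen as 2 x 2 matrices over A. *)
Definition mx2_mul (X Y : 'M[A]_2) : 'M[A]_2 :=
  \matrix_(i, j) \sum_k cmul (X i k) (Y k j).

Definition mx2_star (X : 'M[A]_2) : 'M[A]_2 := \matrix_(i, j) cstar (X j i).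

Definition mx2_scale (c : R[i]) (X : 'M[A]_2) : 'M[A]_2 :=
  \matrix_(i, j) (c *: X i j).

(* iota exhibits the C*-algebra D as A (x) M_2. A *-algebra has at most one
   norm making it a C*-algebra, so D is unique up to an isometric isomorphism
   commuting with iota, and X |-> `|iota X| is the C*-norm of A (x) M_2. It is
   not the entrywise maximum that the library puts on matrices. *)
Definition is_tensor_M2 (D : cstarAlgType R) (iota : 'M[A]_2 -> D) : Prop :=
  [/\ bijective iota,
      forall X Y, iota (X + Y) = iota X + iota Y,
      forall c X, iota (mx2_scale c X) = c *: iota X,
      forall X Y, iota (mx2_mul X Y) = cmul (iota X) (iota Y) &
      forall X, iota (mx2_star X) = cstar (iota X)].

End Amplification.

(* f (x) id acts on 2 x 2 matrices by applying f to each entry. By the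
   uniqueness above, the choice of the realisations of A (x) M_2 and B (x) M_2
   is immaterial. *)
Definition two_contractive (R : realType) (A B : cstarAlgType R)
    (f : {linear A -> B}) : Prop :=
  exists (DA DB : cstarAlgType R) (iA : 'M[A]_2 -> DA) (iB : 'M[B]_2 -> DB),
    [/\ is_tensor_M2 iA, is_tensor_M2 iB &
        forall X : 'M[A]_2, `|iB (map_mx f X)| <= `|iA X|].

Definition directed (I : Type) (le : I -> I -> Prop) : Prop :=
  [/\ inhabited I,
      forall i, le i i,
      forall i j k, le i j -> le j k -> le i k &
      forall i j, exists k, le i k /\ le j k].

Definition net_filter (I : Type) (le : I -> I -> Prop) : set_system I :=
  filter_from setT (fun i => [set j | le i j]).

(* Main.v *)
Require Import Defs.
From HB Require Import structures.
From mathcomp Require Import all_boot all_order all_algebra.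
From mathcomp Require Import complex ring lra zify.
From mathcomp Require Import all_classical all_reals all_analysis.
Import Order.TTheory GRing.Theory Num.Theory.
Import numFieldNormedType.Exports.
Local Open Scope classical_set_scope.
Local Open Scope complex_scope.
Local Open Scope ring_scope.

Set Implicit Arguments.
Unset Strict Implicit.
Unset Printing Implicit Defensive.

(** Write a^* for the adjoint of a. In an abelian C*-algebra the norm of
    f^* f + g^* g is the supremum of |chi f|^2 + |chi g|^2 over the characters
    chi, hence it is the supremum of the norms ||s f + t g||^2 over the scalars
    with |s|^2 + |t|^2 = 1. For f = phi a and g = phi b with phi contractive,
    these are at most the numbers ||s a + t b||^2. A 2-contractive psi does not
    increase the norm of the column (f, g), whose square is ||f^* f + g^* g||.
    In the limit, and because an injective *-homomorphism is isometric, every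
    a and b in A satisfy

      ||a^* a + b^* b|| <= sup { ||s a + t b||^2 : |s|^2 + |t|^2 = 1 }.

    Such an estimate is typical of commutativity: a matrix algebra violates it
    with a and b two matrix units of the same column. To exploit it, take x of
    norm at most 1, a = x y and b = w y where w^2 = 1 - x x^*. By the
    Cauchy-Schwarz inequality s x + t w has norm at most 1, so the right-hand
    side is at most ||y||^2, while the left-hand side is
    ||y^* (1 + x^* x - x x^* ) y||. Hence the self-adjoint element
    h = x^* x - x x^* satisfies ||y^* (1 + h) y|| <= ||y||^2 for all y, and so
    does - h, on replacing x by x^* . This forces h = 0: every element of A is
    normal (normal), and polarization gives commutativity (normal_abelian).

    The facts about C*-algebras on which this rests are derived without
    spectral theory.
    - If k is self-adjoint with ||k|| <= 1, then 1 - k has a square root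
      1 - b (sqrt_one_minus), found by a monotone iteration.
    - If moreover k = h^2, then 1 - b + i h is unitary, so that its imaginary
      part h and its real part 1 - b are contractions
      (sin_cos_contraction). This is the functional calculus that replaces
      spectra: it shows that *-homomorphisms are contractive
      (star_hom_contractive) and, if injective, isometric
      (injective_star_hom_isometric).
    - The C*-norm on 2 x 2 matrices over B replaces the theory of positive
      elements: it yields ||a||^2 <= ||a a^* + b b^*|| (nrm_le_row_M2), and from
      it the Cauchy-Schwarz inequality (nrm_combination).
    - Characters are replaced by a power trick (abelian_sphere_bound): expand
      (f^* f + g^* g)^n by the binomial theorem, bound each monomial by
      averaging powers of s f + t g over roots of unity, and take n-th roots;
      the losses are polynomial in n and disappear. *)

(** * Unitization of a commutative algebra *)

Definition comm_assoc_bilinear (K : comNzRingType) (V : lmodType K)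
    (m : V -> V -> V) : Prop :=
  [/\ commutative m, associative m, left_distributive m +%R &
      forall c x y, m (c *: x) y = c *: m x y].

(** The commutative ring K + V obtained by adjoining a unit to V. It serves
    twice: with the product of an abelian C*-algebra it makes the binomial
    theorem available, and with the zero product it reduces identities between
    linear combinations to identities in a commutative ring. The proof that the
    product is commutative is an argument so that the ring structure can be
    inferred. *)
Definition unitization (K : comNzRingType) (V : lmodType K) (m : V -> V -> V)
  (_ : comm_assoc_bilinear m) : Type := (K * V)%type.

Section Unitization.
Variables (K : comNzRingType) (V : lmodType K) (m : V -> V -> V).
Hypothesis mP : comm_assoc_bilinear m.
Local Notation U := (unitization mP).

HB.instance Definition _ := GRing.Zmodule.on U.

Lemma unitization_eq (u v : U) : u.1 = v.1 -> u.2 = v.2 -> u = v.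
Proof. by case: u v => [a x] [b y] /= -> ->. Qed.

Definition umul (u v : U) : U :=
  (u.1 * v.1, u.1 *: v.2 + v.1 *: u.2 + m u.2 v.2).

Definition uone : U := (1, 0).

Fact umulA : associative umul.
Proof.
case: mP => mC mA mDl mZ [a x] [b y] [c z]; rewrite /umul /=.
have mDr p q r : m p (q + r) = m p q + m p r by rewrite mC mDl !(mC p).
have mZr d p q : m p (d *: q) = d *: m p q by rewrite mC mZ (mC p).
rewrite !mDr !mDl !mZ !mZr !scalerDr !scalerA mA mulrA; congr pair.
rewrite [a * c]mulrC [c * b]mulrC -!addrA; do 2!congr (_ + _).
rewrite addrCA; congr (_ + _); rewrite [RHS]addrCA; congr (_ + _).
by rewrite addrCA.
Qed.

Fact umulC : commutative umul.
Proof.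
case: mP => mC mA mDl mZ [a x] [b y]; rewrite /umul /= mulrC mC.
by rewrite [a *: y + _]addrC.
Qed.

Fact umul1 : left_id uone umul.
Proof.
case: mP => mC mA mDl mZ [a x]; rewrite /umul /= mul1r scale1r scaler0 addr0.
by have -> : m 0 x = 0 by [rewrite -(scale0r 0) mZ !scale0r]; rewrite addr0.
Qed.

Fact umulDl : left_distributive umul +%R.
Proof.
case: mP => mC mA mDl mZ [a x] [b y] [c z]; apply: unitization_eq => /=.
  by rewrite mulrDl.
by rewrite mDl scalerDr !scalerDl [X in X + _ = _]addrACA [LHS]addrACA.
Qed.

Fact uone_neq0 : uone != 0.
Proof. by apply/eqP => /(congr1 fst) /eqP; rewrite oner_eq0. Qed.

HB.instance Definition _ := GRing.Zmodule_isComNzRing.Build U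
  umulA umulC umul1 umulDl uone_neq0.

Definition usnd (u : U) : V := u.2.
Definition uin (x : V) : U := (0, x).
Definition usc (c : K) : U := (c, 0).

Lemma uinK : cancel uin usnd. Proof. by []. Qed.

Lemma uinD x y : uin (x + y) = uin x + uin y.
Proof. by apply: unitization_eq; rewrite /= ?addr0. Qed.
Lemma uinN x : uin (- x) = - uin x.
Proof. by apply: unitization_eq; rewrite /= ?oppr0. Qed.
Lemma uin0 : uin 0 = 0. Proof. by []. Qed.

Lemma uinZ c x : uin (c *: x) = usc c * uin x.
Proof.
case: mP => mC mA mDl mZ.
apply: unitization_eq; rewrite /= ?mulr0 // !scale0r addr0.
by have -> : m 0 x = 0 by [rewrite -(scale0r 0) mZ !scale0r]; rewrite addr0.
Qed.

Lemma uinM x y : uin (m x y) = uin x * uin y.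
Proof. by apply: unitization_eq; rewrite /= ?mulr0 // !scale0r !add0r. Qed.

Fact usc_zmod : zmod_morphism usc.
Proof. by move=> a b; apply: unitization_eq; rewrite /= ?subr0. Qed.
Fact usc_monoid : monoid_morphism usc.
Proof.
case: mP => mC mA mDl mZ; split=> // a b; apply: unitization_eq => //=.
by rewrite !scaler0 !add0r -[in RHS](scale0r (0:V)) mZ scale0r.
Qed.
HB.instance Definition _ := GRing.isZmodMorphism.Build K U usc usc_zmod.
HB.instance Definition _ := GRing.isMonoidMorphism.Build K U usc usc_monoid.
End Unitization.

Fact zero_mul (K : comNzRingType) (V : lmodType K) :
  comm_assoc_bilinear (fun _ _ : V => 0 : V).
Proof. by split=> // [x y z|c x y]; rewrite ?addr0 ?scaler0. Qed.

(** With the zero product, V embeds as a square-zero ideal of a commutative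
    ring in which scaling becomes multiplication. A linear identity in V is
    thus decided by the normalization of polynomials. *)
Definition lmod_eq (K : comNzRingType) (V : lmodType K) :=
  can_inj (@uinK K V _ (@zero_mul K V)).

Ltac lmod_normalize :=
  apply: lmod_eq; rewrite ?(uinD, uinN, uin0, uinZ, rmorphN).

Ltac lmod_ring := lmod_normalize; ring.

(** * The norm as a real number *)

Section RealNorm.
Variables (R : realType) (A : cstarAlgType R).
Implicit Types x y z : A.

Definition nrm x : R := complex.Re `|x|.

Lemma nrmE x : `|x| = (nrm x)%:C.
Proof. by rewrite /nrm RRe_real // normr_real. Qed.

Lemma nrm_ge0 x : 0 <= nrm x.
Proof. by rewrite -ler0c -nrmE. Qed.

Lemma nrm_le x (r : R) : (nrm x <= r) = (`|x| <= r%:C).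
Proof. by rewrite nrmE lecR. Qed.

Lemma nrmD x y : nrm (x + y) <= nrm x + nrm y.
Proof. by rewrite nrm_le rmorphD /= -!nrmE ler_normD. Qed.

Lemma nrmN x : nrm (- x) = nrm x.
Proof. by rewrite /nrm normrN. Qed.

Lemma nrmB x y : nrm (x - y) <= nrm x + nrm y.
Proof. by rewrite -(nrmN y) nrmD. Qed.

Lemma nrm0 : nrm 0 = 0.
Proof. by rewrite /nrm normr0. Qed.

Lemma nrm0_eq0 x : nrm x = 0 -> x = 0.
Proof. by move=> h; apply/normr0_eq0; rewrite nrmE h. Qed.

Lemma nrmZ (c : R[i]) x : nrm (c *: x) = ComplexField.Normc.normc c * nrm x.
Proof.
apply: complexI; rewrite -nrmE normrZ nrmE rmorphM /=; congr (_ * _).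
Qed.

Lemma nrmZR (r : R) x : 0 <= r -> nrm (r%:C *: x) = r * nrm x.
Proof.
move=> r0; rewrite nrmZ; congr (_ * _); rewrite /ComplexField.Normc.normc /=.
by rewrite expr0n addr0 sqrtr_sqr ger0_norm.
Qed.

Lemma nrmM x y : nrm (cmul x y) <= nrm x * nrm y.
Proof. by rewrite nrm_le rmorphM /= -!nrmE norm_cmul_le. Qed.

Lemma nrm_cstar_mul x : nrm (cmul (cstar x) x) = nrm x ^+ 2.
Proof. by apply: complexI; rewrite -nrmE norm_cstar nrmE rmorphXn. Qed.

Lemma nrm_cstar x : nrm (cstar x) = nrm x.
Proof.
have le u : nrm u <= nrm (cstar u).
  have := nrmM (cstar u) u; rewrite nrm_cstar_mul expr2.
  have := nrm_ge0 u; rewrite le_eqVlt => /predU1P[<-|u0]; first by rewrite nrm_ge0.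
  by rewrite ler_pM2r.
by apply/eqP; rewrite eq_le le -{2}(cstarK x) le.
Qed.

Lemma nrm_mul_cstar x : nrm (cmul x (cstar x)) = nrm x ^+ 2.
Proof. by rewrite -{1}(cstarK x) nrm_cstar_mul nrm_cstar. Qed.

Lemma cmul0l x : cmul 0 x = 0.
Proof. by rewrite -(scale0r (0 : A)) cmulZl !scale0r. Qed.
Lemma cmul0r x : cmul x 0 = 0.
Proof. by rewrite -(scale0r (0 : A)) cmulZr !scale0r. Qed.
Lemma cmulNl x y : cmul (- x) y = - cmul x y.
Proof. by apply: (addrI (cmul x y)); rewrite -cmulDl !subrr cmul0l. Qed.
Lemma cmulNr x y : cmul x (- y) = - cmul x y.
Proof. by apply: (addrI (cmul x y)); rewrite -cmulDr !subrr cmul0r. Qed.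
Lemma cstar0 : cstar (0 : A) = 0.
Proof. by rewrite -(scale0r (0 : A)) cstarZ rmorph0 !scale0r. Qed.

Lemma cstarN x : cstar (- x) = - cstar x.
Proof. by apply: (addrI (cstar x)); rewrite -cstarD !subrr cstar0. Qed.

(** Completeness for a sequence with an explicit rate, which the limit
    inherits. *)
Lemma complete_nrm (b : nat -> A) (r : nat -> R) :
  (forall e : R, 0 < e -> exists n, forall m, (n <= m)%N -> r m < e) ->
  (forall n m, (n <= m)%N -> nrm (b m - b n) <= r n) ->
  exists a, forall n, nrm (a - b n) <= r n.
Proof.
move=> r0 bC.
have bcauchy : cauchy (b @ \oo).
  apply: cauchy_exP => e e0.
  have [e'0 eE] : 0 < complex.Re e /\ e = (complex.Re e)%:C.
    by move: (e0); rewrite ltcE => /andP[/eqP ? ?]; split=> //; rewrite RRe_real// gtr0_real.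
  have [n nP] := r0 _ e'0.
  exists (b n); exists n => // m /= nm.
  rewrite -ball_normE /ball_ /= -opprB normrN nrmE eE ltcR.
  exact: le_lt_trans (bC _ _ nm) (nP n _).
have /cauchy_cvgP/cvg_ex[a ba] := bcauchy.
exists a => n; rewrite leNgt; apply/negP => rn.
pose e := nrm (a - b n) - r n.
have e0 : 0 < e by rewrite subr_gt0.
have /cvgrPdist_lt/(_ e%:C) := ba.
rewrite ltcR => /(_ e0)[k _ kP].
have := kP (maxn k n) (leq_maxl _ _); rewrite /= nrmE ltcR.
have := bC n (maxn k n) (leq_maxr _ _).
have := nrmD (a - b (maxn k n)) (b (maxn k n) - b n).
rewrite addrA subrK /e; lra.
Qed.

End RealNorm.
(** Expands products and adjoints into left-nested monomials. Followed by
    lmod_ring it proves the identities that hold in every *-algebra; commutation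
    relations have to be applied to the monomials in between. *)
Ltac calg_expand :=
  rewrite ?(cmulDl, cmulDr, cmulNl, cmulNr, cmulZl, cmulZr, cmul0l, cmul0r,
            cstarD, cstarN, cstar0, cstarZ, cstarM, cstarK, cmulA).

(** * Square roots of 1 - k *)

Section Sqrt.
Variables (R : realType) (A : cstarAlgType R).

Lemma nrm_half (x : A) : nrm (2^-1 *: x) = nrm x / 2.
Proof.
have -> : (2^-1 : R[i]) = (2^-1 : R)%:C by rewrite fmorphV rmorph_nat.
by rewrite nrmZR ?invr_ge0// mulrC.
Qed.

Lemma nrm_double (x : A) : nrm (2 *: x) = 2 * nrm x.
Proof.
have -> : (2 : R[i]) = (2 : R)%:C by rewrite rmorph_nat.
by rewrite nrmZR.
Qed.

(** The scalar case k = 1 of the iteration b := (k + b^2) / 2, whose fixed points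
    are the b with (1 - b)^2 = 1 - k. It increases to 1 and dominates the
    iteration in the algebra term by term. *)
Definition majorant (n : nat) : R := iter n (fun t => (1 + t ^+ 2) / 2) 0.
Definition rate (n : nat) : R := 2 / n.+2%:R.

Lemma rate_gt0 n : 0 < rate n. Proof. by rewrite divr_gt0. Qed.

Lemma rate_small (e : R) : 0 < e -> exists n, forall m, (n <= m)%N -> rate m < e.
Proof.
move=> e0; pose n := Num.bound (2 / e); exists n => m nm.
rewrite ltr_pdivrMr// mulrC -ltr_pdivrMr//.
have := archi_boundP (ltW (divr_gt0 (ltr0n R 2) e0)); rewrite -/n => /lt_le_trans; apply.
by rewrite ler_nat (leq_trans nm)// -addn2 leq_addr.
Qed.

(** How an identity passes to the limit of the iteration. *)
Lemma le_rate_eq0 (x : A) (c : R) : (forall n, nrm x <= c * rate n) -> x = 0.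
Proof.
move=> xr; apply: nrm0_eq0; apply/eqP; rewrite eq_le nrm_ge0 andbT.
apply/ler_addgt0Pl => e e0; rewrite addr0.
have c1 : 0 < `|c| + 1 by rewrite ltr_wpDl.
have [n /(_ _ (leqnn n)) nP] := rate_small (divr_gt0 e0 c1).
apply: (le_trans (xr n)); move: nP; rewrite ltr_pdivlMr//.
have := ler_norm c; have := rate_gt0 n; nra.
Qed.

Lemma majorantS n : majorant n.+1 = (1 + majorant n ^+ 2) / 2.
Proof. by rewrite /majorant iterS. Qed.

Lemma majorant_bounds n :
  [/\ 0 <= majorant n, majorant n <= majorant n.+1, majorant n <= 1 &
      1 - majorant n <= rate n].
Proof.
suff [? [? ?]] : 0 <= majorant n /\ majorant n <= 1 /\ 1 - majorant n <= rate n.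
  by split=> //; rewrite majorantS; have := sqr_ge0 (1 - majorant n); lra.
elim: n => [|n [IH0 [IH1 IH2]]]; first by rewrite /majorant /rate /=; lra.
rewrite majorantS; move: IH0 IH1 IH2; rewrite /rate.
move: (majorant n) => b b0 b1.
have -> : n.+3%:R = n.+2%:R + 1 :> R by rewrite natr1.
have : (0 : R) < n.+2%:R by [].
move: (n.+2%:R : R) => N N0; rewrite ler_pdivlMr// => bN.
have : b ^+ 2 <= 1 by rewrite expr_le1.
have := sqr_ge0 b => bb0 bb1; split; first lra.
split; first lra.
rewrite ler_pdivlMr; last lra.
nra.
Qed.

Variable k : A.
Hypotheses (k_sa : cstar k = k) (k1 : nrm k <= 1).

Definition visser (n : nat) : A := iter n (fun b => 2^-1 *: (k + cmul b b)) 0.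

Lemma visserS n : visser n.+1 = 2^-1 *: (k + cmul (visser n) (visser n)).
Proof. by rewrite /visser iterS. Qed.

(** The increments are b_(n+1) (b_(n+1) - b_n) + (b_(n+1) - b_n) b_n up to a
    factor 1/2, so that their norms obey the recursion of the increments of the
    majorant. *)
Lemma visser_bounds n :
  nrm (visser n) <= majorant n /\
  nrm (visser n.+1 - visser n) <= majorant n.+1 - majorant n.
Proof.
have bnd m : nrm (visser m) <= majorant m.
  elim: m => [|m IH]; first by rewrite nrm0.
  rewrite visserS nrm_half majorantS.
  have := nrmD k (cmul (visser m) (visser m)); have := nrmM (visser m) (visser m).
  have v0 := nrm_ge0 (visser m); have := ler_pM v0 v0 IH IH; rewrite expr2.
  by move: k1; lra.
split=> //; elim: n => [|n IH].
  rewrite visserS majorantS /visser /majorant /= cmul0l addr0 subr0 nrm_half expr0n /=.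
  by move: k1; lra.
have -> : visser n.+2 - visser n.+1 = 2^-1 *:
    (cmul (visser n.+1) (visser n.+1 - visser n) +
     cmul (visser n.+1 - visser n) (visser n)).
  rewrite (visserS n.+1) {2}(visserS n); calg_expand; lmod_ring.
rewrite nrm_half.
have := nrmD (cmul (visser n.+1) (visser n.+1 - visser n))
             (cmul (visser n.+1 - visser n) (visser n)).
have := nrmM (visser n.+1) (visser n.+1 - visser n).
have := nrmM (visser n.+1 - visser n) (visser n).
have := bnd n; have := bnd n.+1; have := nrm_ge0 (visser n.+1 - visser n).
have -> : majorant n.+2 - majorant n.+1 =
  (majorant n.+1 + majorant n) * (majorant n.+1 - majorant n) / 2.
  by rewrite (majorantS n.+1) {2}(majorantS n); field.
have [a0 _ _ _] := majorant_bounds n; have [b0 _ _ _] := majorant_bounds n.+1.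
set u := nrm (visser n); set v := nrm (visser n.+1).
have u0 : 0 <= u := nrm_ge0 _. have v0 : 0 <= v := nrm_ge0 _.
move: IH; set d := nrm (_ - _); set D := majorant n.+1 - majorant n => IH d0 hv hu m1 m2 m3.
have : v * d <= majorant n.+1 * D by exact: ler_pM.
have : d * u <= D * majorant n by exact: ler_pM.
nra.
Qed.

Lemma visser_cauchy n m : (n <= m)%N -> nrm (visser m - visser n) <= rate n.
Proof.
move=> nm; have [_ _ _] := majorant_bounds n; apply: le_trans.
have [_ _ m1 _] := majorant_bounds m.
suff : nrm (visser m - visser n) <= majorant m - majorant n by lra.
elim: m nm {m1} => [|m IH]; first by rewrite leqn0 => /eqP ->; rewrite !subrr nrm0.
rewrite leq_eqVlt => /predU1P[->|]; first by rewrite !subrr nrm0.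
rewrite ltnS => /IH; have [_] := visser_bounds m.
by have := nrmD (visser m.+1 - visser m) (visser m - visser n); rewrite addrA subrK; lra.
Qed.

(** The equation says that (1 - b)^2 = 1 - k, written without the unit that the
    algebra may lack. The element b is a limit of polynomials in k, which is why
    it commutes with what commutes with k. *)
Lemma sqrt_one_minus :
  exists b : A, [/\ cstar b = b, nrm b <= 1, 2 *: b - cmul b b = k &
    forall d, cmul d k = cmul k d -> cmul d b = cmul b d].
Proof.
have [b bP] := complete_nrm rate_small visser_cauchy.
exists b.
have v1 n : nrm (visser n) <= 1.
  by have [+ _] := visser_bounds n; have [_ _ ? _] := majorant_bounds n; lra.
have b1 : nrm b <= 1.
  apply/ler_addgt0Pl => e e0; have [n /(_ _ (leqnn n)) nP] := rate_small e0.
  have := nrmD (b - visser n) (visser n); rewrite subrK.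
  by have := bP n; have := v1 n; lra.
split=> //.
- apply/eqP; rewrite -subr_eq0; apply/eqP; apply: (@le_rate_eq0 _ 2) => n.
  have vsa : cstar (visser n) = visser n.
    elim: n => [|n IH]; first exact: cstar0.
    by rewrite visserS; calg_expand; rewrite k_sa IH fmorphV rmorph_nat.
  have -> : cstar b - b = cstar (b - visser n) - (b - visser n).
    calg_expand; rewrite vsa; lmod_ring.
  have := nrmB (cstar (b - visser n)) (b - visser n).
  by rewrite nrm_cstar; have := bP n; lra.
- apply/eqP; rewrite -subr_eq0; apply/eqP; apply: (@le_rate_eq0 _ 4) => n.
  have -> : 2 *: b - cmul b b - k = 2 *: (b - visser n.+1) -
     (cmul b (b - visser n) + cmul (b - visser n) (visser n)).
    rewrite visserS scalerBr scalerA divff// ?pnatr_eq0// scale1r.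
    calg_expand; lmod_ring.
  apply: (le_trans (nrmB _ _)); rewrite nrm_double.
  have := nrmD (cmul b (b - visser n)) (cmul (b - visser n) (visser n)).
  have := nrmM b (b - visser n). have := nrmM (b - visser n) (visser n).
  have rn : rate n.+1 <= rate n.
    by rewrite ler_pM2l// lef_pV2 ?posrE// ler_nat.
  have := bP n; have := bP n.+1; have := v1 n; have := nrm_ge0 (b - visser n).
  nra.
move=> d dk; apply/eqP; rewrite -subr_eq0; apply/eqP; apply: (@le_rate_eq0 _ (2 * nrm d)) => n.
have dv : cmul d (visser n) = cmul (visser n) d.
  elim: n => [|n IH]; first by rewrite /visser /= cmul0l cmul0r.
  by rewrite visserS; calg_expand; rewrite dk IH -cmulA IH cmulA.
have -> : cmul d b - cmul b d = cmul d (b - visser n) - cmul (b - visser n) d.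
  calg_expand; rewrite dv; lmod_ring.
apply: (le_trans (nrmB _ _)).
have := nrmM d (b - visser n); have := nrmM (b - visser n) d.
have := bP n; have := nrm_ge0 d; nra.
Qed.
End Sqrt.

(** * Contractions from unitaries *)

Section Unitary.
Variables (R : realType) (A : cstarAlgType R).

(** With c = 1 - b, the hypotheses say that c^2 + h^2 = 1, so c + i h and
    c - i h are unitary: multiplication by either preserves norms. Half their sum
    and half their difference are c and i h. *)
Lemma sin_cos_contraction (h b : A) :
    cstar h = h -> cstar b = b -> cmul h b = cmul b h ->
    2 *: b - cmul b b = cmul h h ->
  forall y, nrm (cmul h y) <= nrm y /\ nrm (y - cmul b y) <= nrm y.
Proof.
move=> hs bs hb hh y.
have iso (j : R[i]) : Num.conj j = - j -> j * j = -1 ->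
    nrm (y - cmul b y + j *: cmul h y) = nrm y.
  move=> jc j2; apply/eqP; rewrite -(@eqrXn2 _ 2) ?nrm_ge0//; apply/eqP.
  rewrite -!nrm_cstar_mul; congr nrm.
  have hbz z : cmul (cmul z h) b = cmul (cmul z b) h by rewrite -!cmulA hb.
  have hhz z : cmul (cmul z h) h = 2 *: cmul z b - cmul (cmul z b) b.
    by rewrite -cmulA -hh; calg_expand.
  calg_expand; rewrite hs bs jc hbz hhz; calg_expand.
  have J : @usc _ A _ (zero_mul A) j * usc (zero_mul A) j = -1.
    by rewrite -rmorphM j2 rmorphN rmorph1.
  by lmod_normalize; ring: J.
pose I : R[i] := 'i%R.
have II : I * I = -1 by rewrite -expr2 sqrCi.
have Ic : Num.conj I = - I := conjCi _.
have i1 := iso I Ic II.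
have i2 := iso (- I).
rewrite rmorphN /= Ic mulrNN in i2; have {}i2 := i2 erefl II.
split; rewrite -(ler_pM2l (ltr0n R 2)).
  have -> : 2 * nrm (cmul h y) = nrm ((2 * I) *: cmul h y).
    rewrite nrmZ mulrC ComplexField.Normc.normcM.
    have -> : ComplexField.Normc.normc I = 1.
      by rewrite /I -complexiE /= expr0n expr1n add0r sqrtr1.
    rewrite mulr1 mulrC; congr (_ * _).
    by rewrite /= addr0 expr0n addr0 sqrtr_sqr ger0_norm.
  have -> : (2 * I) *: cmul h y =
    (y - cmul b y + I *: cmul h y) - (y - cmul b y + (- I) *: cmul h y).
    by lmod_ring.
  by apply: le_trans (nrmB _ _) _; rewrite i1 i2; lra.
rewrite -nrm_double.
have -> : 2 *: (y - cmul b y) =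
    (y - cmul b y + I *: cmul h y) + (y - cmul b y + (- I) *: cmul h y).
  by lmod_ring.
by apply: le_trans (nrmD _ _) _; rewrite i1 i2; lra.
Qed.
End Unitary.

(** * Star homomorphisms *)

Section Hom.
Variables (R : realType).

Lemma nrm_sa_sqr (A : cstarAlgType R) (h : A) : cstar h = h -> nrm (cmul h h) = nrm h ^+ 2.
Proof. by move=> hs; rewrite -nrm_cstar_mul hs. Qed.

Lemma contraction_le1 (A : cstarAlgType R) (h : A) : cstar h = h ->
  (forall y, nrm (cmul h y) <= nrm y) -> nrm h <= 1.
Proof.
move=> hs /(_ h); rewrite nrm_sa_sqr// expr2.
have := nrm_ge0 h; rewrite le_eqVlt => /predU1P[<-//|h0].
by rewrite -{3}[nrm h]mul1r ler_pM2r.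
Qed.

Lemma sin_cos_le1 (A : cstarAlgType R) (h b : A) :
    cstar h = h -> cstar b = b -> cmul h b = cmul b h ->
    2 *: b - cmul b b = cmul h h -> nrm h <= 1.
Proof.
by move=> hs bs hb hh; apply: contraction_le1 => // y; have [] := sin_cos_contraction hs bs hb hh y.
Qed.

Lemma conj_real (r : R) : Num.conj (r%:C) = r%:C.
Proof. exact: conjc_real. Qed.

Lemma nrm_normalize (A : cstarAlgType R) (x : A) :
  x != 0 -> nrm ((nrm x)^-1%:C *: x) = 1.
Proof.
move=> x0; rewrite nrmZR ?invr_ge0 ?nrm_ge0// mulVf//.
by apply: contra x0 => /eqP/nrm0_eq0 ->.
Qed.

(** If n is a sine, so is q = 2 n (1 - be), where 1 - be is the corresponding
    cosine, and the cosine of the double angle is 1 - 2 n^2 = 1 - l. *)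
Lemma double_angle (A : cstarAlgType R) (n l : A) :
    cstar n = n -> nrm n <= 1 -> 2 *: cmul n n = l ->
  exists q, [/\ cstar q = q, cmul q l = cmul l q & 2 *: l - cmul l l = cmul q q].
Proof.
move=> ns n1 nn.
have [||be [bes be1 beE beC]] := @sqrt_one_minus _ _ (cmul n n).
- by rewrite cstarM ns.
- by rewrite nrm_sa_sqr// expr_le1// nrm_ge0.
have nbe : cmul n be = cmul be n by rewrite beC// cmulA.
have nbez z : cmul (cmul z be) n = cmul (cmul z n) be by rewrite -!cmulA nbe.
have bebe z : cmul (cmul z be) be = 2 *: cmul z be - cmul (cmul z n) n.
  by rewrite -!cmulA -beE; calg_expand; lmod_ring.
exists (2 *: n - 2 *: cmul n be); rewrite -nn; split.
- by calg_expand; rewrite rmorph_nat ns bes nbe.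
- by calg_expand; rewrite ?(nbez, bebe); lmod_ring.
- by calg_expand; rewrite ?(nbez, bebe); calg_expand; lmod_ring.
Qed.

Variables (A B : cstarAlgType R) (f : {linear A -> B}).
Hypothesis f_hom : star_hom f.

Lemma cstar_mul_self (x : A) : cstar (cmul (cstar x) x) = cmul (cstar x) x.
Proof. by rewrite cstarM cstarK. Qed.

(** The equation that makes a self-adjoint element of the unit ball a sine is
    algebraic, hence preserved by f. *)
Lemma star_hom_contractive x : nrm (f x) <= nrm x.
Proof.
have [fM fS] := f_hom.
have unitball h : cstar h = h -> nrm h <= 1 -> nrm (f h) <= 1.
  move=> hs h1; have [||b [bs b1 bE bC]] := @sqrt_one_minus _ _ (cmul h h).
  - by rewrite cstarM hs.
  - by rewrite nrm_sa_sqr// expr_le1// nrm_ge0.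
  apply: (@sin_cos_le1 _ (f h) (f b)); rewrite -?fS ?hs ?bs -?fM//.
    by rewrite bC// cmulA.
  by rewrite -bE linearB linearZ.
have sa h : cstar h = h -> nrm (f h) <= nrm h.
  move=> hs; have [->|h0] := eqVneq h 0; first by rewrite linear0 !nrm0.
  have := unitball ((nrm h)^-1%:C *: h); rewrite nrm_normalize// cstarZ conj_real hs => /(_ erefl (lexx _)).
  have h0' : 0 < nrm h.
    by rewrite lt_neqAle nrm_ge0 andbT eq_sym; apply: contra h0 => /eqP/nrm0_eq0 ->.
  by rewrite linearZ nrmZR ?invr_ge0 ?nrm_ge0// mulrC ler_pdivrMr// mul1r.
rewrite -(@ler_pXn2r _ 2) ?nnegrE ?nrm_ge0//.
by rewrite -!nrm_cstar_mul -fS -fM sa// cstar_mul_self.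
Qed.

Hypothesis f_inj : injective f.

(** Why f cannot shrink a self-adjoint m: set l = m^2, which has norm
    in ]1, 2], whereas f l has norm < 1. The element K = 2 l - l^2, for which
    1 - K = (1 - l)^2, has norm at most 1 as the square of a sine. The square
    root 1 - b of 1 - K is |1 - l|, with b of norm at most 1. In the target the
    square roots 1 - f l and 1 - f b of 1 - f K must agree because
    ||f l + f b|| < 2, so l = b by injectivity, but l has norm > 1. *)
Let no_shrink (m : A) : cstar m = m -> 1 < nrm m -> nrm m ^+ 2 <= 2 -> nrm (f m) < 1 -> False.
Proof.
have [fM fS] := f_hom => ms m1 m2 fm1.
pose l := cmul m m.
have [n [ns nn]] : exists n, cstar n = n /\ 2 *: cmul n n = l.
  exists ((Num.sqrt (2^-1 : R))%:C *: m); split.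
    by rewrite cstarZ conj_real ms.
  rewrite cmulZl cmulZr !scalerA -?mulrA -rmorphM /= -expr2 sqr_sqrtr ?invr_ge0//.
  by rewrite fmorphV rmorph_nat divff ?pnatr_eq0// scale1r.
have n1 : nrm n <= 1.
  rewrite -(@expr_le1 _ 2) ?nrm_ge0// -nrm_sa_sqr//.
  by have := nrm_double (cmul n n); rewrite nn (nrm_sa_sqr ms); lra.
have [q [qs ql qq]] := double_angle ns n1 nn.
have ls : cstar l = l by rewrite cstarM ms.
have q1 : nrm q <= 1 by apply: (@sin_cos_le1 _ q l).
have [||b [bs b1 bE bC]] := @sqrt_one_minus _ _ (cmul q q).
- by rewrite cstarM qs.
- by rewrite nrm_sa_sqr// expr_le1// nrm_ge0.
have bl : cmul l b = cmul b l by apply: bC; rewrite -qq; calg_expand.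
have fd : 2 *: (f l - f b) = cmul (f l - f b) (f l + f b).
  have -> : cmul (f l - f b) (f l + f b) = f (cmul l l) - f (cmul b b) + (f (cmul l b) - f (cmul b l)).
    by rewrite !fM; calg_expand; lmod_ring.
  rewrite bl subrr addr0.
  have -> : cmul b b = cmul l l - 2 *: l + 2 *: b.
    by apply: (addrI (- cmul b b + 2 *: b)); rewrite -[2 *: l](subrK (cmul l l)) qq -bE; lmod_ring.
  by rewrite !(linearD, linearN, linearZ) /=; lmod_ring.
(* d := f l - f b satisfies 2 d = d (f l + f b), where the last factor has norm
   smaller than 2. *)
have d0 : nrm (f l - f b) = 0.
  have := nrm_double (f l - f b); rewrite fd.
  have := nrmM (f l - f b) (f l + f b); have := nrmD (f l) (f b).
  have := star_hom_contractive b.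
  have fl : nrm (f l) < 1 by rewrite /l fM nrm_sa_sqr -?fS ?ms// expr_lt1// nrm_ge0.
  have := nrm_ge0 (f l - f b); nra.
have := f_inj (subr0_eq (nrm0_eq0 d0)) => lb.
by have : nrm l <= 1; [rewrite lb | rewrite /l nrm_sa_sqr//; nra].
Qed.

Lemma injective_star_hom_isometric x : nrm (f x) = nrm x.
Proof.
have [fM fS] := f_hom.
have sa h : cstar h = h -> nrm h <= nrm (f h).
  move=> hs; rewrite leNgt; apply/negP => lt.
  have h0 : 0 < nrm h by exact: le_lt_trans (nrm_ge0 _) lt.
  have fh0 := nrm_ge0 (f h).
  (* This factor brings the norm of h into ]1, 4/3], so its square is at most 2,
     and keeps the norm of f h below 1. *)
  pose s := 4 / (nrm (f h) + 3 * nrm h).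
  have d0 : 0 < nrm (f h) + 3 * nrm h by lra.
  have s0 : 0 <= s by rewrite divr_ge0// ltW.
  apply: (@no_shrink (s%:C *: h)).
  - by rewrite cstarZ conj_real hs.
  - by rewrite nrmZR// /s mulrAC ltr_pdivlMr//; lra.
  - have v0 : 0 <= s * nrm h by rewrite mulr_ge0 ?nrm_ge0.
    have v1 : s * nrm h <= 4 / 3 by rewrite /s mulrAC ler_pdivrMr//; lra.
    by rewrite nrmZR//; nra.
  - by rewrite linearZ_LR nrmZR// /s mulrAC ltr_pdivrMr//; lra.
apply/eqP; rewrite eq_le star_hom_contractive /= -(@ler_pXn2r _ 2) ?nnegrE ?nrm_ge0//.
by rewrite -!nrm_cstar_mul -fS -fM sa// cstar_mul_self.
Qed.
End Hom.

(** * Two by two matrices *)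

Section Tensor.
Variables (R : realType) (A : cstarAlgType R).

Definition mx22 (a b c d : A) : 'M[A]_2 :=
  \matrix_(i, j) if i == 0 then if j == 0 then a else b
                 else if j == 0 then c else d.

Lemma mx22_mul a b c d a' b' c' d' :
  mx2_mul (mx22 a b c d) (mx22 a' b' c' d') =
  mx22 (cmul a a' + cmul b c') (cmul a b' + cmul b d')
       (cmul c a' + cmul d c') (cmul c b' + cmul d d').
Proof.
apply/matrixP => i j; rewrite !mxE !big_ord_recl big_ord0 addr0 !mxE /=.
by do 2![case: ifP => _].
Qed.

Lemma mx22_star a b c d :
  mx2_star (mx22 a b c d) = mx22 (cstar a) (cstar c) (cstar b) (cstar d).
Proof. by apply/matrixP => i j; rewrite !mxE; do 2![case: ifP => _]. Qed.

Lemma mx22_add a b c d a' b' c' d' :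
  mx22 a b c d + mx22 a' b' c' d' = mx22 (a + a') (b + b') (c + c') (d + d').
Proof. by apply/matrixP => i j; rewrite !mxE; do 2![case: ifP => _]. Qed.

Lemma mx22_scale k a b c d :
  mx2_scale k (mx22 a b c d) = mx22 (k *: a) (k *: b) (k *: c) (k *: d).
Proof. by apply/matrixP => i j; rewrite !mxE; do 2![case: ifP => _]. Qed.

Variables (D : cstarAlgType R) (iota : 'M[A]_2 -> D).
Hypothesis iotaP : is_tensor_M2 iota.

(** The proof that iota presents the matrix algebra is an argument so that the
    linearity of the map can be inferred. *)
Definition corner (_ : is_tensor_M2 iota) (a : A) : D := iota (mx22 a 0 0 0).

Fact corner_linear : linear (corner iotaP).
Proof.
have [_ iD iZ _ _] := iotaP; move=> k a b.
by rewrite /corner -iZ -iD mx22_scale mx22_add !scaler0 !addr0.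
Qed.
HB.instance Definition _ := GRing.isLinear.Build R[i] A D *:%R (corner iotaP) corner_linear.

Lemma corner_star_hom : star_hom (corner iotaP).
Proof.
have [_ _ _ iM iS] := iotaP; split=> [a b|a]; rewrite /corner.
  by rewrite -iM mx22_mul !cmul0l !cmul0r !addr0.
by rewrite -iS mx22_star !cstar0.
Qed.

Lemma corner_inj : injective (corner iotaP).
Proof.
have [[g gK _] _ _ _ _] := iotaP => a b /(can_inj gK)/matrixP/(_ 0 0).
by rewrite !mxE.
Qed.

(** The embedding of A in its 2 x 2 matrices is an injective *-homomorphism,
    hence isometric: this relates the norm on matrices to that of A. *)
Lemma nrm_corner a : nrm (iota (mx22 a 0 0 0)) = nrm a.
Proof. exact: (injective_star_hom_isometric corner_star_hom corner_inj). Qed.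

Lemma nrm_column a b :
  nrm (iota (mx22 a 0 b 0)) ^+ 2 = nrm (cmul (cstar a) a + cmul (cstar b) b).
Proof.
have [_ _ _ iM iS] := iotaP.
rewrite -nrm_cstar_mul -iS -iM mx22_star mx22_mul.
by rewrite !cstar0 !cmul0l !cmul0r !addr0 nrm_corner.
Qed.

Lemma nrm_row a b :
  nrm (iota (mx22 a b 0 0)) ^+ 2 = nrm (cmul a (cstar a) + cmul b (cstar b)).
Proof.
have [_ _ _ iM iS] := iotaP.
rewrite -nrm_mul_cstar -iS -iM mx22_star mx22_mul.
by rewrite !cstar0 !cmul0l !cmul0r !addr0 nrm_corner.
Qed.

(** The rows (a, b) and (a, - b) have the same norm, and their half sum is
    (a, 0). This is the one instance of the monotonicity of the norm on positive
    elements that is called for. *)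
Lemma nrm_le_row_M2 (a b : A) :
  nrm a ^+ 2 <= nrm (cmul a (cstar a) + cmul b (cstar b)).
Proof.
have [_ iD _ _ _] := iotaP.
rewrite -nrm_row ler_pXn2r ?nnegrE ?nrm_ge0//.
have E : nrm (iota (mx22 a (- b) 0 0)) = nrm (iota (mx22 a b 0 0)).
  apply/eqP; rewrite -(@eqrXn2 _ 2) ?nrm_ge0//; apply/eqP.
  by rewrite !nrm_row cstarN cmulNl cmulNr opprK.
have : iota (mx22 a b 0 0) + iota (mx22 a (- b) 0 0) = 2 *: iota (mx22 a 0 0 0).
  by rewrite -iD mx22_add subrr !addr0 scaler_nat mulr2n -iD mx22_add !addr0.
move/(congr1 (@nrm R D)); rewrite nrm_double nrm_corner => h.
by have := nrmD (iota (mx22 a b 0 0)) (iota (mx22 a (- b) 0 0)); rewrite h E; lra.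
Qed.
End Tensor.

Lemma two_contractive_column (R : realType) (F B : cstarAlgType R) (psi : {linear F -> B}) :
  two_contractive psi -> forall f g : F,
  nrm (cmul (cstar (psi f)) (psi f) + cmul (cstar (psi g)) (psi g)) <=
  nrm (cmul (cstar f) f + cmul (cstar g) g).
Proof.
move=> [DF [DB [iF [iB [iFP iBP psi_le]]]]] f g.
rewrite -(nrm_column iFP) -(nrm_column iBP) ler_pXn2r ?nnegrE ?nrm_ge0//.
have := psi_le (mx22 f 0 g 0).
have -> : map_mx psi (mx22 f 0 g 0) = mx22 (psi f) 0 (psi g) 0.
  by apply/matrixP => i j; rewrite !mxE; do 2![case: ifP => _]; rewrite ?linear0.
by rewrite !nrmE lecR.
Qed.

(** * Binomial coefficients and roots of unity *)

Local Notation normc := ComplexField.Normc.normc.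

(** The binomial distribution of parameters n and k / n has its mode at k, so
    its value there is at least 1 / (n + 1). *)
Lemma binomial_mode n k : (k <= n)%N ->
  (n ^ n <= n.+1 * ('C(n, k) * (k ^ k * (n - k) ^ (n - k))))%N.
Proof.
move=> kn; set l := (n - k)%N.
pose T j := ('C(n, j) * (k ^ j * l ^ (n - j)))%N.
have stepE j : (j < n)%N -> exists X, T j = (X * l)%N /\ (j.+1 * T j.+1 = (n - j) * k * X)%N.
  move=> jn; exists ('C(n, j) * (k ^ j * l ^ (n - j.+1)))%N; rewrite /T; split.
    by rewrite -!mulnA -expnSr -subSn// subSS.
  by rewrite mulnA mul_bin_left expnS; lia.
have up j : (j < k)%N -> (T j <= T j.+1)%N.
  move=> jk; have [X [-> E]] := stepE _ (leq_trans jk kn).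
  rewrite -(@leq_pmul2l j.+1)// E; have : (j.+1 * l <= k * (n - j))%N by apply: leq_mul => //; rewrite /l; lia.
  nia.
have down j : (k <= j)%N -> (j < n)%N -> (T j.+1 <= T j)%N.
  move=> kj jn; have [X [-> E]] := stepE _ jn.
  rewrite -(@leq_pmul2l j.+1)// E; have : ((n - j) * k <= l * j.+1)%N by apply: leq_mul => //; rewrite /l; lia.
  nia.
have below d : (d <= k)%N -> (T (k - d) <= T k)%N.
  elim: d => [|d IH] dk; first by rewrite subn0.
  by apply: leq_trans (IH (ltnW dk)); rewrite -(subnSK dk); apply: up; lia.
have above d : (k + d <= n)%N -> (T (k + d) <= T k)%N.
  elim: d => [|d IH] dk; first by rewrite addn0.
  by rewrite addnS; apply: leq_trans (IH _); [apply: down|]; lia.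
have Tk j : (j <= n)%N -> (T j <= T k)%N.
  move=> jn; have [jk|kj] := leqP j k.
    by rewrite -(subKn jk); apply: below; exact: leq_subr.
  by rewrite -(subnKC (ltnW kj)); apply: above; rewrite subnKC// ltnW.
have -> : (n ^ n = \sum_(i < n.+1) 'C(n, i) * (l ^ (n - i) * k ^ i))%N.
  by rewrite -expnDn /l subnK.
have -> : (n.+1 * T k = \sum_(i < n.+1) T k)%N by rewrite sum_nat_const card_ord.
apply: leq_sum => i _.
by rewrite [(l ^ _ * _)%N]mulnC; apply: Tk; rewrite -ltnS.
Qed.

Section RootsOfUnity.
Variables (R : realType).

Lemma normr_normc (z : R[i]) : `|z| = (normc z)%:C.
Proof. by case: z => a b; rewrite normc_def. Qed.

Lemma normcX (z : R[i]) n : normc (z ^+ n) = normc z ^+ n.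
Proof. by apply: complexI; rewrite rmorphXn /= -!normr_normc normrX. Qed.

Lemma normc_real (r : R) : 0 <= r -> normc r%:C = r.
Proof. by move=> r0; rewrite /= expr0n addr0 sqrtr_sqr ger0_norm. Qed.

(** An iterated square root of -1 has order exactly a power of 2; such orders
    are as large as one wants. *)
Lemma exists_primitive_root a : exists w : R[i], (2 ^ a.+1).-primitive_root w.
Proof.
pose w : R[i] := (2 ^ a).-root (-1).
have wa : w ^+ (2 ^ a) = -1 by rewrite rootCK// expn_gt0.
have wN : w ^+ (2 ^ a.+1) = 1 by rewrite expnS mulnC exprM wa sqrrN expr1n.
have [|m mw /(dvdn_pfactor _ _ (isT : prime 2))[b ba mE]] := prim_order_exists _ wN.
  by rewrite expn_gt0.
exists w; suff <- : m = (2 ^ a.+1)%N by [].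
rewrite mE; congr (2 ^ _)%N; apply/eqP; rewrite eqn_leq ba ltnNge; apply/negP => ba'.
have : (m %| 2 ^ a)%N by rewrite mE dvdn_exp2l.
rewrite (prim_order_dvd mw) wa.
by rewrite eq_sym -subr_eq0 opprK -[1 + 1]/(2%:R) pnatr_eq0.
Qed.

Lemma sum_primitive_root N (w : R[i]) d : N.-primitive_root w ->
  \sum_(i < N) (w ^+ d) ^+ i = if (N %| d)%N then N%:R else 0.
Proof.
move=> wN; rewrite (prim_order_dvd wN); case: eqP => [->|/eqP d1].
  by under eq_bigr do rewrite expr1n; rewrite sumr_const card_ord.
apply/(mulfI (x := w ^+ d - 1)); first by rewrite subr_eq0.
by rewrite -subrX1 -exprM mulnC exprM (prim_expr_order wN) expr1n subrr mulr0.
Qed.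

Lemma normc_primitive_root N (w : R[i]) : N.-primitive_root w -> normc w = 1.
Proof.
move=> wN; apply/eqP; rewrite -(@pexpr_eq1 _ _ N) ?(prim_order_gt0 wN)//.
  by rewrite -normcX (prim_expr_order wN) ComplexField.Normc.normc1.
by rewrite -ler0c -normr_normc.
Qed.
End RootsOfUnity.

(** * The column norm in an abelian algebra *)

Fact abelian_mul (R : realType) (F : cstarAlgType R) :
  abelian_cstar F -> comm_assoc_bilinear (@cmul R F).
Proof. by move=> ab; split=> //; [exact: cmulA | exact: cmulDl | exact: cmulZl]. Qed.

(** Taking n-th roots of a bound with polynomial losses. With y the fourth root
    of a ratio x > 1, Bernoulli's inequality makes y^(4 n) grow faster than
    (n + 1)^2. *)
Lemma pow_le_poly (R : realType) (r m : R) : 0 <= r -> 0 <= m ->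
  (forall j, r ^+ (2 ^ j).-1 <= (2 ^ j)%:R ^+ 2 * m ^+ (2 ^ j).-1) -> r <= m.
Proof.
move=> r0 m0 H; rewrite leNgt; apply/negP => mr.
pose m' := (m + r) / 2.
have m'0 : 0 < m' by rewrite /m'; lra.
pose x := r / m'.
have x1 : 1 < x by rewrite /x ltr_pdivlMr// /m'; lra.
pose y := Num.sqrt (Num.sqrt x).
have y4 : y ^+ 4 = x.
  by rewrite (exprM y 2 2) /y !sqr_sqrtr ?sqrtr_ge0//; lra.
have y1 : 1 < y.
  by rewrite -sqrtr1 ltr_sqrt ?sqrtr_gt0; [rewrite -sqrtr1 ltr_sqrt|]; lra.
pose d := y - 1.
have d0 : 0 < d by rewrite /d; lra.
have bern n : 1 + n%:R * d <= y ^+ n.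
  have -> : y = 1 + d by rewrite /d addrC subrK.
  elim: n => [|n]; first by rewrite expr0 mul0r addr0.
  rewrite exprS -natr1; move: (_ ^+ n) (n%:R : R) (ler0n R n) => z k k0 zk.
  have : 0 <= d * (z - (1 + k * d)) by rewrite mulr_ge0 ?subr_ge0// ltW.
  have : 0 <= k * d ^+ 2 by rewrite mulr_ge0 ?sqr_ge0.
  lra.
have Hx j : ((2 ^ j).-1)%:R * d ^+ 2 <= 1.
  set n := (2 ^ j).-1.
  have nE : (2 ^ j)%N = n.+1 by rewrite /n prednK// expn_gt0.
  have xn : x ^+ n <= n.+1%:R ^+ 2.
    rewrite /x expr_div_n ler_pdivrMr ?exprn_gt0//.
    apply: le_trans (H j) _; rewrite nE /= ler_wpM2l ?exprn_ge0//.
    by apply: lerXn2r; rewrite ?nnegrE /m'; lra.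
  have yn : (y ^+ n) ^+ 2 <= n.+1%:R.
    rewrite -(@ler_pXn2r _ 2) ?nnegrE ?exprn_ge0//; last by lra.
    by rewrite -!exprM -mulnA mulnC exprM y4.
  have n0 := ler0n R n; have := bern n; move: yn; rewrite -natr1.
  set z := y ^+ n; set k : R := n%:R.
  have k0 : 0 <= k by [].
  move=> zk kz; have kd : 0 <= k * d by rewrite mulr_ge0// ltW.
  have h : (1 + k * d) ^+ 2 <= z ^+ 2 by rewrite !expr2; apply: ler_pM; lra.
  have [->|k1] := eqVneq k 0; first by rewrite mul0r ler01.
  have kp : 0 < k by rewrite lt_neqAle eq_sym k1.
  by rewrite -(ler_pM2l kp); lra.
have D0 : 0 < d ^+ 2 by rewrite exprn_gt0.
pose j := Num.bound (d ^+ 2)^-1.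
have := archi_boundP (ltW (_ : 0 < (d ^+ 2)^-1)); rewrite invr_gt0 => /(_ D0).
rewrite -/j -(ltr_pM2r D0) mulVf ?gt_eqF//.
suff : j%:R * d ^+ 2 <= ((2 ^ j).-1)%:R * d ^+ 2 by have := Hx j; lra.
rewrite ler_pM2r// ler_nat; have := ltn_expl j (ltnSn 1); lia.
Qed.

Section Abelian.
Variables (R : realType) (F : cstarAlgType R).
Hypothesis F_ab : abelian_cstar F.
Let mP := abelian_mul F_ab.
Local Notation U := (unitization mP).

(** Since F is an ideal of its unitization, every element of the latter acts on
    F. Operator bounds for this action stand for the norm of the
    unitization. *)
Definition act (u : U) (y : F) : F := usnd (u * uin mP y).

Lemma uin_act u y : uin mP (act u y) = u * uin mP y.
Proof. by apply: unitization_eq; rewrite //= mulr0. Qed.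

Definition opbound (u : U) (c : R) := forall y, nrm (act u y) <= c * nrm y.

Lemma act1 y : act 1 y = y.
Proof. by rewrite /act mul1r. Qed.

Lemma actM u v y : act (u * v) y = act u (act v y).
Proof. by rewrite {2}/act uin_act mulrA. Qed.

Lemma actD u v y : act (u + v) y = act u y + act v y.
Proof. by rewrite /act mulrDl. Qed.

Lemma act_sc c y : act (usc mP c) y = c *: y.
Proof. by rewrite /act -uinZ. Qed.

Lemma act_in x y : act (uin mP x) y = cmul x y.
Proof. by rewrite /act -uinM. Qed.

Lemma opboundM u v c d : 0 <= c -> opbound u c -> opbound v d -> opbound (u * v) (c * d).
Proof.
move=> c0 uc vd y; rewrite actM; apply: le_trans (uc _) _.
by rewrite -mulrA ler_wpM2l.
Qed.

Lemma opboundX u c n : 0 <= c -> opbound u c -> opbound (u ^+ n) (c ^+ n).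
Proof.
move=> c0 uc; elim: n => [|n IH]; first by move=> y; rewrite act1 mul1r.
by rewrite !exprS; apply: opboundM.
Qed.

Lemma opbound_sum (I : finType) (u : I -> U) (c : I -> R) :
  (forall i, opbound (u i) (c i)) -> opbound (\sum_i u i) (\sum_i c i).
Proof.
move=> uc; elim/big_rec2 : _ => [|i d v _ IH] y.
  by rewrite /act mul0r mul0r nrm0.
rewrite actD mulrDl; apply: le_trans (nrmD _ _) _; apply: lerD; [exact: uc|exact: IH].
Qed.

Lemma opbound_sc c : opbound (usc mP c) (normc c).
Proof. by move=> y; rewrite act_sc nrmZ. Qed.

Lemma opbound_unsc (k : R[i]) u c : k != 0 -> opbound (usc mP k * u) c ->
  opbound u (c / normc k).
Proof.
move=> k0 kc y; have := kc y; rewrite actM act_sc nrmZ.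
have nk : 0 < normc k.
  by rewrite lt_neqAle -ler0c -normr_normc normr_ge0 andbT eq_sym; apply: contra k0 => /eqP/ComplexField.Normc.eq0_normc ->.
by rewrite mulrAC ler_pdivlMr// mulrC.
Qed.

Definition sphere_bound (P Q : U) (mu : R) :=
  forall s t : R[i], normc s ^+ 2 + normc t ^+ 2 = 1 ->
  opbound (usc mP s * P + usc mP t * Q) mu.

(** Each term of the binomial expansion of (s P + t Q)^n is a Fourier
    coefficient of z |-> (z s P + t Q)^n, so it is an average over roots of unity
    z of elements bounded by mu^n. *)
Lemma opbound_coefficient (P Q : U) mu n k (s t : R) : 0 <= mu -> (k <= n)%N ->
  sphere_bound P Q mu -> 0 <= s -> 0 <= t -> s ^+ 2 + t ^+ 2 = 1 ->
  opbound (usc mP ('C(n, k)%:R * (s ^+ k * t ^+ (n - k))%:C) * (P ^+ k * Q ^+ (n - k))) (mu ^+ n).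
Proof.
move=> mu0 kn PQ s0 t0 st.
have [w wN] := exists_primitive_root R n; set N := (2 ^ n.+1)%N in wN.
have nN : (n < N)%N by rewrite /N; have := ltn_expl n.+1 (ltnSn 1); lia.
have w1 := normc_primitive_root wN.
(* N - k stands for the exponent - k, which makes the average select the k-th
   coefficient. *)
pose term i := usc mP (w ^+ ((N - k) * i)) *
    (usc mP (w ^+ i * s%:C) * P + usc mP t%:C * Q) ^+ n.
have termB (i : 'I_N) : opbound (term i) (mu ^+ n).
  rewrite -[mu ^+ n]mul1r; apply: opboundM => //.
    by move=> y; apply: le_trans (opbound_sc _ _) _; rewrite normcX w1 expr1n.
  apply: opboundX => //; apply: PQ.
  by rewrite ComplexField.Normc.normcM normcX w1 expr1n mul1r !normc_real.
pose X (j : 'I_n.+1) : U :=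
  usc mP ('C(n, j)%:R * (s ^+ j * t ^+ (n - j))%:C) * (P ^+ j * Q ^+ (n - j)).
have termE (i : 'I_N) : term i = \sum_(j < n.+1) usc mP ((w ^+ (N - k + j)) ^+ i) * X j.
  rewrite /term addrC exprDn mulr_sumr; apply: eq_bigr => j _.
  rewrite /X -mulr_natl !exprMn -!rmorphXn -(rmorph_nat (usc mP)) exprMn -exprM.
  rewrite rmorphM !rmorphXn /= -exprM mulnDl exprD [(j * i)%N]mulnC !rmorphM /=.
  rewrite !(rmorphXn (real_complex R)) !rmorphXn /=; ring.
have sumE : \sum_(i < N) term i = usc mP N%:R * X (inord k).
  under eq_bigr do rewrite termE.
  rewrite exchange_big /=.
  under eq_bigr do rewrite -mulr_suml -rmorph_sum /= (sum_primitive_root _ wN).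
  have kn' : (k < n.+1)%N by [].
  rewrite (bigD1 (inord k)) //= big1 ?addr0.
    by rewrite inordK// subnK ?dvdnn//; lia.
  move=> j jk; rewrite ifN ?rmorph0 ?mul0r//.
  apply: contra jk => /dvdnP[q qE]; apply/eqP/val_inj; rewrite /= inordK//.
  have := ltn_ord j; move: q qE => [|[|q]]; lia.
have h := opbound_sum termB; rewrite sumE in h.
have N0 : (N%:R : R[i]) != 0 by rewrite pnatr_eq0; lia.
move: (opbound_unsc N0 h); rewrite /X inordK// sumr_const card_ord -[mu ^+ n *+ _]mulr_natr.
have -> : (N%:R : R[i]) = (N%:R : R)%:C by rewrite rmorph_nat.
rewrite normc_real// mulfK//; last by rewrite pnatr_eq0; lia.
Qed.

(** The weights s^2 = k / n and t^2 = 1 - k / n put the mode of the binomial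
    distribution at k, so that the bound loses only a factor n + 1. *)
Lemma opbound_monomial (P Q : U) mu n k : 0 <= mu -> (0 < n)%N -> (k <= n)%N ->
  sphere_bound P Q mu ->
  exists c, [/\ 0 <= c, opbound (P ^+ k * Q ^+ (n - k)) c &
    'C(n, k)%:R * c ^+ 2 <= n.+1%:R * mu ^+ (2 * n)].
Proof.
move=> mu0 n0 kn PQ.
have n0' : (0 : R) < n%:R by rewrite ltr0n.
pose s : R := Num.sqrt (k%:R / n%:R); pose t : R := Num.sqrt ((n - k)%:R / n%:R).
have s2 : s ^+ 2 = k%:R / n%:R by rewrite sqr_sqrtr// divr_ge0.
have t2 : t ^+ 2 = (n - k)%:R / n%:R by rewrite sqr_sqrtr// divr_ge0.
have st : s ^+ 2 + t ^+ 2 = 1.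
  by rewrite s2 t2 -mulrDl -natrD subnKC// divff// gt_eqF.
have mode : 1 <= n.+1%:R * ('C(n, k)%:R * ((s ^+ k * t ^+ (n - k)) ^+ 2)) :> R.
  rewrite exprMn -!exprM ![(_ * 2)%N]mulnC !exprM s2 t2 !expr_div_n.
  rewrite mulf_div -exprD subnKC// !mulrA ler_pdivlMr ?exprn_gt0// mul1r.
  rewrite -!natrX -!natrM ler_nat -!mulnA; exact: binomial_mode.
have := opbound_coefficient mu0 kn PQ (sqrtr_ge0 _) (sqrtr_ge0 _) st.
set a := s ^+ k * t ^+ (n - k) in mode *.
have a0 : 0 <= a by rewrite mulr_ge0 ?exprn_ge0 ?sqrtr_ge0.
set K : R := 'C(n, k)%:R in mode *.
have K0 : 0 < K by rewrite ltr0n bin_gt0.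
have a0' : 0 < a.
  rewrite lt_neqAle a0 andbT eq_sym; apply/eqP => a00.
  by move: mode; rewrite a00 expr0n !mulr0; lra.
have -> : 'C(n, k)%:R * a%:C = (K * a)%:C :> R[i] by rewrite [RHS]rmorphM /= /K rmorph_nat.
have Ka0 : 0 < K * a by rewrite mulr_gt0.
move/opbound_unsc; rewrite normc_real ?ltW// => h.
exists (mu ^+ n / (K * a)); split.
- exact: divr_ge0 (exprn_ge0 _ mu0) (ltW Ka0).
- by apply: h; rewrite -(rmorph0 (real_complex R)) (inj_eq (@complexI R)) gt_eqF.
rewrite expr_div_n -exprM [(n * 2)%N]mulnC mulrA ler_pdivrMr ?exprn_gt0//.
have M0 : 0 <= mu ^+ (2 * n) by rewrite exprn_ge0.
have : 0 <= K * mu ^+ (2 * n) by rewrite mulr_ge0// ltW.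
move=> /ler_wpM2l/(_ _ _ mode); rewrite mulr1 => KM; apply: le_trans KM _.
by rewrite le_eqVlt; apply/orP; left; apply/eqP; ring.
Qed.

Lemma sphere_bound_uin (f g : F) mu :
  (forall s t : R[i], normc s ^+ 2 + normc t ^+ 2 = 1 -> nrm (s *: f + t *: g) <= mu) ->
  sphere_bound (uin mP f) (uin mP g) mu.
Proof.
move=> fg s t st y; rewrite actD !actM !act_sc !act_in -!cmulZl -cmulDl.
by apply: le_trans (nrmM _ _) _; rewrite ler_wpM2r ?nrm_ge0 ?fg.
Qed.

(** For Pb and Qb the adjoints of P and Q, each term of the binomial expansion
    is a monomial in P and Q times its adjoint. *)
Lemma opbound_exp_sum (P Q Pb Qb : U) mu n : 0 <= mu -> (0 < n)%N ->
  sphere_bound P Q mu -> sphere_bound Pb Qb mu ->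
  opbound ((Pb * P + Qb * Q) ^+ n) (n.+1%:R ^+ 2 * (mu ^+ 2) ^+ n).
Proof.
move=> mu0 n0 PQ PQb; set K := n.+1%:R * mu ^+ (2 * n).
have -> : n.+1%:R ^+ 2 * (mu ^+ 2) ^+ n = \sum_(i < n.+1) K :> R.
  by rewrite sumr_const card_ord -exprM -[K *+ _]mulr_natl /K [RHS]mulrA -expr2.
rewrite addrC exprDn; apply: opbound_sum => i.
have i_n : (i <= n)%N by rewrite -ltnS.
have [c [c0 cP cK]] := opbound_monomial mu0 n0 i_n PQ.
have [d [d0 dP dK]] := opbound_monomial mu0 n0 i_n PQb.
have -> : (Qb * Q) ^+ (n - i) * (Pb * P) ^+ i *+ 'C(n, i) =
  usc mP 'C(n, i)%:R * (Pb ^+ i * Qb ^+ (n - i) * (P ^+ i * Q ^+ (n - i))).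
  by rewrite rmorph_nat mulr_natl !exprMn; congr (_ *+ _); ring.
move=> y; rewrite actM act_sc nrmZ.
have -> : normc ('C(n, i)%:R : R[i]) = 'C(n, i)%:R.
  by rewrite -[RHS]normc_real// rmorph_nat.
have C0 : (0 : R) <= 'C(n, i)%:R by [].
apply: le_trans (ler_wpM2l C0 (opboundM d0 dP cP y)) _.
rewrite mulrA ler_wpM2r ?nrm_ge0//.
have : 0 <= 'C(n, i)%:R * (c - d) ^+ 2 by rewrite mulr_ge0 ?sqr_ge0.
move: cK dK; rewrite -/K; move: ('C(n, i)%:R : R) K => C K'; lra.
Qed.

(** The exponent is a power of 2 so that the C*-identity for self-adjoint
    elements can be iterated. *)
Lemma nrm_sa_pow (e : F) j : cstar e = e ->
  nrm (act (uin mP e ^+ (2 ^ j).-1) e) = nrm e ^+ (2 ^ j).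
Proof.
move=> es.
have powE n : uin mP (act (uin mP e ^+ n) e) = uin mP e ^+ n.+1.
  by rewrite uin_act -exprSr.
pose p i := act (uin mP e ^+ (2 ^ i).-1) e.
have pE i : uin mP (p i) = uin mP e ^+ (2 ^ i).
  by rewrite powE prednK// expn_gt0.
have pS i : p i.+1 = cmul (p i) (p i).
  by apply: (can_inj (@uinK _ _ _ mP)); rewrite uinM !pE -exprD addnn -mul2n -expnS.
suff [//] : nrm (p j) = nrm e ^+ (2 ^ j) /\ cstar (p j) = p j.
elim: j => [|j [IH ps]]; first by rewrite /p act1 expr1.
rewrite pS nrm_sa_sqr// IH cstarM ps; split=> //.
by rewrite -exprM expnS mulnC.
Qed.

Lemma abelian_sphere_bound (f g : F) mu : 0 <= mu ->
  (forall s t : R[i], normc s ^+ 2 + normc t ^+ 2 = 1 -> nrm (s *: f + t *: g) <= mu) ->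
  nrm (cmul (cstar f) f + cmul (cstar g) g) <= mu ^+ 2.
Proof.
move=> mu0 fg.
have fgs (s t : R[i]) : normc s ^+ 2 + normc t ^+ 2 = 1 -> nrm (s *: cstar f + t *: cstar g) <= mu.
  move=> st; have := fg (Num.conj s) (Num.conj t).
  have nc z : normc (Num.conj z : R[i]) = normc z.
    by apply: complexI; rewrite -!normr_normc norm_conjC.
  by rewrite !nc => /(_ st); rewrite -nrm_cstar cstarD !cstarZ !conjCK.
set e := _ + _.
have es : cstar e = e by rewrite cstarD !cstarM !cstarK.
apply: pow_le_poly; rewrite ?nrm_ge0 ?sqr_ge0// => j.
have [->|e0] := eqVneq (nrm e) 0.
  have [->|n0] := posnP (2 ^ j).-1; first by rewrite !expr0 mulr1 exprn_ege1// ler1n expn_gt0.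
  by rewrite expr0n gtn_eqF// mulr_ge0 ?exprn_ge0.
have ep : 0 < nrm e by rewrite lt_neqAle eq_sym e0 nrm_ge0.
have [->|n0] := posnP (2 ^ j).-1; first by rewrite !expr0 mulr1 exprn_ege1// ler1n expn_gt0.
have := opbound_exp_sum mu0 n0 (sphere_bound_uin fg) (sphere_bound_uin fgs).
rewrite -!uinM -uinD -/e => /(_ e); rewrite nrm_sa_pow//.
have nE : (2 ^ j)%N = (2 ^ j).-1.+1 by rewrite prednK// expn_gt0.
by rewrite {1}nE exprSr -nE ler_pM2r.
Qed.

End Abelian.

(** * Normality of all elements *)

Section Normal.
Variables (R : realType) (A : cstarAlgType R).

Definition rows_dominate := forall a b : A,
  nrm a ^+ 2 <= nrm (cmul a (cstar a) + cmul b (cstar b)).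

Definition columns_below_sphere := forall (a b : A) (mu : R), 0 <= mu ->
  (forall s t : R[i], normc s ^+ 2 + normc t ^+ 2 = 1 -> nrm (s *: a + t *: b) <= mu) ->
  nrm (cmul (cstar a) a + cmul (cstar b) b) <= mu ^+ 2.

Hypothesis rowsA : rows_dominate.
Hypothesis colsA : columns_below_sphere.

(** Cauchy-Schwarz. A unitary change of the scalars turns the row (a, c) into
    (s a + t c, t^* a - s^* c), where a a^* + c c^* keeps its value. *)
Lemma nrm_combination (a c : A) (s t : R[i]) : normc s ^+ 2 + normc t ^+ 2 = 1 ->
  nrm (s *: a + t *: c) ^+ 2 <= nrm (cmul a (cstar a) + cmul c (cstar c)).
Proof.
move=> st.
have sc : s * Num.conj s + t * Num.conj t = 1.
  by rewrite -!normCK !normr_normc -!rmorphXn -rmorphD /= st.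
have := rowsA (s *: a + t *: c) (Num.conj t *: a - Num.conj s *: c).
suff -> : cmul (s *: a + t *: c) (cstar (s *: a + t *: c)) +
   cmul (Num.conj t *: a - Num.conj s *: c) (cstar (Num.conj t *: a - Num.conj s *: c)) =
   cmul a (cstar a) + cmul c (cstar c) by [].
calg_expand; rewrite !conjCK.
rewrite -[RHS]scale1r -sc; lmod_ring.
Qed.

Section Defect.
Variables (x : A).
Hypothesis x1 : nrm x <= 1.

(** The hypothesis on columns applied to x y and w y, where w = 1 - c is the
    square root of 1 - x x^* . The element v = (s x + t w) y has norm at most
    ||y||: v^* v is p y with p = v^* (s x + t w), and Cauchy-Schwarz bounds p by
    the norm of v because x x^* + w^2 = 1. *)
Lemma defect_form y :
  nrm (cmul (cstar y) y + cmul (cmul (cstar y) (cmul (cstar x) x - cmul x (cstar x))) y)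
    <= nrm y ^+ 2.
Proof.
have [||c [cs c1 cE _]] := @sqrt_one_minus _ _ (cmul x (cstar x)).
- by rewrite cstarM cstarK.
- by rewrite nrm_mul_cstar expr_le1// nrm_ge0.
have ccz z : cmul (cmul z c) c = 2 *: cmul z c - cmul (cmul z x) (cstar x).
  by rewrite -!cmulA -cE; calg_expand; lmod_ring.
have := @colsA (cmul x y) (y - cmul c y) _ (nrm_ge0 y).
have -> : cmul (cstar (cmul x y)) (cmul x y) + cmul (cstar (y - cmul c y)) (y - cmul c y) =
  cmul (cstar y) y + cmul (cmul (cstar y) (cmul (cstar x) x - cmul x (cstar x))) y.
  by calg_expand; rewrite cs ccz; calg_expand; lmod_ring.
apply=> s t st; move vE : (_ + _) => v.
pose p := s *: cmul (cstar v) x + t *: (cstar v - cmul (cstar v) c).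
have py : cmul p y = cmul (cstar v) v.
  by rewrite -[X in _ = cmul _ X]vE /p; calg_expand; lmod_ring.
have pv : nrm p <= nrm v.
  rewrite -(@ler_pXn2r _ 2) ?nnegrE ?nrm_ge0//.
  apply: le_trans (nrm_combination _ _ st) _.
  rewrite -(nrm_cstar_mul v).
  have -> : cmul (cmul (cstar v) x) (cstar (cmul (cstar v) x)) +
     cmul (cstar v - cmul (cstar v) c) (cstar (cstar v - cmul (cstar v) c)) = cmul (cstar v) v.
    calg_expand; rewrite cs ccz; calg_expand; lmod_ring.
  by [].
have := nrmM p y; rewrite py nrm_cstar_mul expr2.
have [->|v0] := eqVneq (nrm v) 0; first by rewrite nrm_ge0.
have vp : 0 < nrm v by rewrite lt_neqAle eq_sym v0 nrm_ge0.
by move=> h; rewrite -(ler_pM2l vp); apply: le_trans h _; rewrite ler_wpM2r ?nrm_ge0.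
Qed.
End Defect.

(** Let k be h scaled to norm 1 by r = ||h||. Testing the two bounds on h
    against y = k gives ||k^2 + r k^3|| <= 1 and ||k^2 - r k^3|| <= 1, and
    adding the squares, ||k^4 + r^2 k^6|| <= 1. Since also
    ||k^4 - 2 k^6|| <= 1, by sin_cos_contraction at the double angle, the
    difference (2 + r^2) k^6 has norm at most 2. But k^6 has norm 1. *)
Lemma normal_le1 (x : A) : nrm x <= 1 -> cmul (cstar x) x = cmul x (cstar x).
Proof.
move=> x1; apply/eqP; rewrite -subr_eq0; apply/eqP.
set h := _ - _.
have hs : cstar h = h by rewrite /h; calg_expand.
have hp y : nrm (cmul (cstar y) y + cmul (cmul (cstar y) h) y) <= nrm y ^+ 2.
  exact: defect_form.
have hm y : nrm (cmul (cstar y) y - cmul (cmul (cstar y) h) y) <= nrm y ^+ 2.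
  have := @defect_form (cstar x) _ y; rewrite nrm_cstar cstarK => /(_ x1).
  by rewrite -[cmul x _ - _]opprB cmulNr cmulNl.
clearbody h.
apply/eqP; apply/negPn/negP => h0.
have rp : 0 < nrm h.
  by rewrite lt_neqAle nrm_ge0 andbT eq_sym; apply: contra h0 => /eqP/nrm0_eq0 ->.
pose r := nrm h.
pose k := r^-1%:C *: h.
have k1 : nrm k = 1 by rewrite nrm_normalize.
have ks : cstar k = k by rewrite cstarZ conj_real hs.
have hk : h = r%:C *: k by rewrite scalerA -rmorphM mulfV ?gt_eqF// scale1r.
pose k2 := cmul k k. pose k4 := cmul k2 k2.
have k2s : cstar k2 = k2 by rewrite cstarM ks.
have k4s : cstar k4 = k4 by rewrite cstarM k2s.
have k21 : nrm k2 = 1 by rewrite nrm_sa_sqr// k1 expr1n.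
have k41 : nrm k4 = 1 by rewrite nrm_sa_sqr// k21 expr1n.
have k81 : nrm (cmul k4 k4) = 1 by rewrite nrm_sa_sqr// k41 expr1n.
have k61 : 1 <= nrm (cmul k2 k4).
  by have := nrmM k2 (cmul k2 k4); rewrite cmulA -/k4 k81 k21 mul1r.
have := hm k; have := hp k.
rewrite ks k1 hk expr1n => hp1 hm1.
have sum : nrm (k4 + (r ^+ 2)%:C *: cmul k2 k4) <= 1.
  move: hp1 hm1; set P := _ + _; set Q := _ - _ => P1 Q1.
  have := nrm_double (k4 + (r ^+ 2)%:C *: cmul k2 k4).
  have -> : 2 *: (k4 + (r ^+ 2)%:C *: cmul k2 k4) = cmul P P + cmul Q Q.
    by rewrite rmorphXn /P /Q /k4 /k2; calg_expand; lmod_ring.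
  have := nrmD (cmul P P) (cmul Q Q); have := nrmM P P; have := nrmM Q Q.
  have := ler_pM (nrm_ge0 P) (nrm_ge0 P) P1 P1.
  have := ler_pM (nrm_ge0 Q) (nrm_ge0 Q) Q1 Q1.
  lra.
have dif : nrm (k4 - 2 *: cmul k2 k4) <= 1.
  have [|q [qs ql qq]] := double_angle ks _ (erefl (2 *: k2)); first by rewrite k1.
  have ls : cstar (2 *: k2) = 2 *: k2 by rewrite cstarZ rmorph_nat k2s.
  have [_] := sin_cos_contraction qs ls ql qq k4.
  by rewrite cmulZl k41.
have E : (2 + r ^+ 2)%:C *: cmul k2 k4 = (k4 + (r ^+ 2)%:C *: cmul k2 k4) - (k4 - 2 *: cmul k2 k4).
  by rewrite rmorphD rmorph_nat; lmod_ring.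
have r20 : 0 < r ^+ 2 by rewrite exprn_gt0.
have := congr1 (@nrm R A) E; rewrite nrmZR; last by lra.
have := nrmB (k4 + (r ^+ 2)%:C *: cmul k2 k4) (k4 - 2 *: cmul k2 k4).
move: k61 sum dif r20; nra.
Qed.

Lemma normal (x : A) : cmul (cstar x) x = cmul x (cstar x).
Proof.
have [->|x0] := eqVneq x 0; first by rewrite cstar0.
have := normal_le1 (_ : nrm ((nrm x)^-1%:C *: x) <= 1); rewrite nrm_normalize// => /(_ (lexx _)).
calg_expand; rewrite !scalerA => /scalerI; apply.
rewrite mulf_neq0// ?conjC_eq0 -(rmorph0 (real_complex R)) (inj_eq (@complexI R)) invr_eq0;
 by apply: contra x0 => /eqP/nrm0_eq0 ->.
Qed.

(** Polarization of the normality of x + c y, at c = 1 and c = i. *)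
Lemma normal_abelian : abelian_cstar A.
Proof.
suff star (x y : A) : cmul (cstar x) y = cmul y (cstar x).
  by move=> x y; rewrite -(cstarK x) star.
pose j : R[i] := 'i%R.
have jc : Num.conj j = - j := conjCi _.
have jj : usc (zero_mul A) j * usc (zero_mul A) j = -1.
  by rewrite -rmorphM -expr2 sqrCi rmorphN rmorph1.
have polar (c : R[i]) :
    c *: cmul (cstar x) y + Num.conj c *: cmul (cstar y) x =
    Num.conj c *: cmul x (cstar y) + c *: cmul y (cstar x).
  have := normal (x + c *: y); calg_expand; rewrite !normal => /eqP.
  rewrite -subr_eq0 => /eqP E; apply/eqP; rewrite -subr_eq0 -{}E; apply/eqP.
  by lmod_ring.
have := polar j; have := polar 1; rewrite jc rmorph1 !scale1r => e1 ej.
apply: (scalerI (_ : (2 : R[i]) != 0)); first by rewrite pnatr_eq0.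
have -> : 2 *: cmul (cstar x) y =
  (cmul (cstar x) y + cmul (cstar y) x) -
    j *: (j *: cmul (cstar x) y + (- j) *: cmul (cstar y) x).
  by lmod_normalize; ring: jj.
rewrite ej e1.
by lmod_normalize; ring: jj.
Qed.
End Normal.

(** * Passage to the limit *)

Lemma nrm_square_diff (R : realType) (B : cstarAlgType R) (u v : B) (e : R) :
  nrm (u - v) <= e ->
  nrm (cmul (cstar u) u - cmul (cstar v) v) <= e * (2 * nrm u + e).
Proof.
move=> uv.
have -> : cmul (cstar u) u - cmul (cstar v) v =
  cmul (cstar u) (u - v) + cmul (cstar (u - v)) v by calg_expand; lmod_ring.
apply: le_trans (nrmD _ _) _.
have := nrmM (cstar u) (u - v); have := nrmM (cstar (u - v)) v; rewrite !nrm_cstar.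
have v1 : nrm v <= nrm u + e.
  by have := nrmB u (u - v); rewrite opprB addrCA subrr addr0; lra.
have := ler_pM (nrm_ge0 (u - v)) (nrm_ge0 v) uv v1.
have := ler_wpM2l (nrm_ge0 u) uv.
lra.
Qed.

Lemma net_cvg0 (R : realType) (B : cstarAlgType R) (I : Type)
    (le : I -> I -> Prop) (u : I -> B) :
  (fun i => `|u i| : R[i]^o) @ net_filter le --> (0 : R[i]^o) ->
  forall e : R, 0 < e -> exists i, forall j, le i j -> nrm (u j) < e.
Proof.
move=> u0 e e0; have e0' : 0 < e%:C by rewrite ltcR.
have [i _ iP] := u0 _ (@nbhsx_ballx _ R[i]^o 0 _ e0').
exists i => j ij; have := iP _ ij.
by rewrite /= -ball_normE /ball_ /= sub0r normrN normr_id nrmE ltcR.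
Qed.

Unset Implicit Arguments.

Theorem theorem3p2 (R : realType) (A B : cstarAlgType R)
    (theta : {linear A -> B})
    (theta_cont : continuous theta)
    (theta_hom : star_hom theta)
    (theta_inj : injective theta)
    (I : Type) (le : I -> I -> Prop) (le_dir : directed le)
    (F : I -> cstarAlgType R)
    (F_abelian : forall i, abelian_cstar (F i))
    (phi : forall i, {linear A -> F i})
    (phi_cont : forall i, continuous (phi i))
    (phi_contr : forall i, contractive (phi i))
    (psi : forall i, {linear F i -> B})
    (psi_cont : forall i, continuous (psi i))
    (psi_contr : forall i, two_contractive (psi i))
    (approx : forall x : A,
       (fun i => `|theta x - psi i (phi i x)| : R[i]^o) @ net_filter le --> (0 : R[i]^o)) :
  abelian_cstar A.
Proof.
have [I0 _ _ le_up] := le_dir.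
have [i0] := I0.
have theta_iso := injective_star_hom_isometric theta_hom theta_inj.
have [thM thS] := theta_hom.
apply: normal_abelian.
  have [_ [DB [_ [iB [_ iBP _]]]]] := psi_contr i0.
  move=> a b; rewrite -!theta_iso linearD !thM !thS; exact: nrm_le_row_M2 iBP _ _.
move=> a b mu mu0 ab; rewrite -theta_iso linearD !thM !thS.
apply/ler_addgt0Pl => e e0.
(* If theta a and theta b are approximated up to d <= 1, then a^* a + b^* b is
   approximated up to d K. *)
pose K := 2 * nrm (theta a) + 2 * nrm (theta b) + 2.
have K0 : 0 < K by have := nrm_ge0 (theta a); have := nrm_ge0 (theta b); rewrite /K; lra.
pose d := Num.min 1 (e / K).
have d0 : 0 < d by rewrite lt_min ltr01 divr_gt0.
have d1 : d <= 1 by rewrite ge_min lexx.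
have dK : d * K <= e by rewrite -ler_pdivlMr// ge_min lexx orbT.
have [i iP] := net_cvg0 (approx a) d0.
have [j jP] := net_cvg0 (approx b) d0.
have [k [ik jk]] := le_up i j.
have da := nrm_square_diff (ltW (iP _ ik)).
have db := nrm_square_diff (ltW (jP _ jk)).
have pab := two_contractive_column (psi_contr k) (phi k a) (phi k b).
have fab : nrm (cmul (cstar (phi k a)) (phi k a) + cmul (cstar (phi k b)) (phi k b)) <= mu ^+ 2.
  apply: abelian_sphere_bound (F_abelian k) _ _ _ mu0 _ => s t st.
  rewrite -!linearZ -linearD; apply: le_trans (ab s t st).
  by have := phi_contr k (s *: a + t *: b); rewrite !nrmE lecR.
move: pab da db.
set u1 := cmul _ (psi k _); set u2 := cmul _ (psi k _).
set v1 := cmul _ (theta a); set v2 := cmul _ (theta b) => pab da db.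
have := nrmD (v1 - u1 + (v2 - u2)) (u1 + u2).
have := nrmD (v1 - u1) (v2 - u2).
have -> : v1 - u1 + (v2 - u2) + (u1 + u2) = v1 + v2 by lmod_ring.
have := ler_wpM2l (ltW d0) d1.
move: da db pab fab dK; rewrite /K; lra.
Qed.
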